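(* Let $\lambda>0$ and $\alpha\geq 0$ be given. Suppose $(Z_t^{\alpha})_{t\geq 0}$ is a timing process induced by the inter-renewal time $\exp(\lambda)$ and started at $\alpha$. Then, for any $t\geq 0$, $$\mathbb{P}[Z_t^{\alpha}\leq z]=\begin{cases} 0 & z\in(-\infty,0),\\ 1-e^{-\lambda z} & z\in[0,t),\\ 1-e^{-\lambda t} & z\in[t,t+\alpha),\\ 1 & z\in[t+\alpha,\infty).\end{cases}$$
   Context: Timing process: let $(X_i)_{i\in\mathbb{N}}$ ($\mathbb{N}=\{1,2,\dots\}$, $\mathbb{N}_0=\mathbb{N}\cup\{0\}$) be a sequence of positive i.i.d. random variables on a probability space $(\Omega,\mathcal{F},\mathbb{P})$. Put $Y_n=\sum_{i=1}^n X_i$ for $n\in\mathbb{N}_0$ (so $Y_0=0$), and for $t\geq 0$ define $Z_t=\inf\{t-Y_n : n\in\mathbb{N}_0,\ t-Y_n\geq 0\}$. The process $(Z_t)_{t\geq 0}$ is called the timing process with renewal times $(Y_n)$ and inter-renewal times $(X_i)$, or the timing process induced by inter-renewal time $X$ (where $X$ has the common law of the $X_i$). ''Inter-renewal time $\exp(\lambda)$'' means that the $X_i$ are exponentially distributed with rate $\lambda$ (mean $1/\lambda$). Timing process started at $\alpha$: let $(Z_t)_{t\geq 0}$ be a timing process induced by inter-renewal time $X$. For $\alpha\geq 0$ not an upper bound on the range of $X$ (so any $\alpha\ge 0$ in the exponential case), let $\tau_\alpha=\inf\{t\geq 0 : Z_t=\alpha\}$ be the first hitting time of $\alpha$ and define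 $Z_t^{\alpha}=Z_{\tau_\alpha+t}$ for $t\geq 0$. The process $(Z_t^{\alpha})_{t\geq 0}$ is called the timing process started at $\alpha$. (In the exponential case $\tau_\alpha<\infty$ almost surely, so the process is defined almost surely.) *)

(* Defs.v *)
From mathcomp Require Import all_boot all_order all_algebra finmap.
From mathcomp Require Import all_classical all_reals all_analysis.

Set Implicit Arguments.
Unset Strict Implicit.
Unset Printing Implicit Defensive.

Import Order.TTheory GRing.Theory Num.Theory.
Import numFieldNormedType.Exports.

Local Open Scope classical_set_scope.
Local Open Scope ring_scope.

Definition mutually_independent (d : measure_display) (Omega : measurableType d)
    (R : realType) (P : probability Omega R) (X : nat -> {RV P >-> R}) : Prop :=
  forall (J : {fset nat}) (A : nat -> set R),
    (forall i, measurable (A i)) ->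
    P (\bigcap_(i in [set` J]) (X i @^-1` A i)) =
    (\prod_(i <- J) P (X i @^-1` A i))%E.

(* The sequence is indexed from 0: [X i] is the (i+1)-st inter-renewal time.
   Laws are compared on Borel sets only, since set functions such as
   [distribution P (X i)] carry no meaning on non-measurable sets. *)
Definition inter_renewal_times (d : measure_display) (Omega : measurableType d)
    (R : realType) (P : probability Omega R) (mu : set R -> \bar R)
    (X : nat -> {RV P >-> R}) : Prop :=
  [/\ forall i w, 0 < X i w,
      mutually_independent X
    & forall i (A : set R), measurable A -> distribution P (X i) A = mu A].

Definition renewal_time (Omega : Type) (R : realType)
    (X : nat -> Omega -> R) (n : nat) (w : Omega) : R :=
  \sum_(i < n) X i w.

(* For t >= 0 the set contains t (take n = 0) and is bounded below by 0, so
   this is a genuine infimum; negative times are never used. *)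
Definition timing_process (Omega : Type) (R : realType)
    (X : nat -> Omega -> R) (t : R) (w : Omega) : R :=
  inf [set t - renewal_time X n w | n in [set n | 0 <= t - renewal_time X n w]].

(* Equal to +oo when the level alpha is never reached. *)
Definition hitting_time (Omega : Type) (R : realType)
    (X : nat -> Omega -> R) (alpha : R) (w : Omega) : \bar R :=
  ereal_inf [set s%:E | s in [set s : R | 0 <= s /\ timing_process X s w = alpha]].

(* Where the hitting time is +oo, [fine] returns 0 and the unshifted process is
   used; for exponential inter-renewal times this happens with probability 0. *)
Definition timing_process_from (Omega : Type) (R : realType)
    (X : nat -> Omega -> R) (alpha t : R) (w : Omega) : R :=
  timing_process X (fine (hitting_time X alpha w) + t) w.

(* Main.v *)
(* Let Y_N be the first renewal followed by a gap X_N > alpha; then the hitting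
   time of alpha is Y_N + alpha and the time of observation is
   T = Y_N + alpha + t.  For 0 <= z < t + alpha put c = min z t.  Almost surely,
   Z_T > z holds if and only if no renewal falls in [T - c, T], that is, for some
   n >= N the gap X_n exceeds the positive time r_n from Y_n to T - c by more
   than c.  Set r_n = alpha + t - c for n < N; this creates no further such n, and
   r_n becomes a function of X_0, ..., X_(n-1), hence independent of X_n.  By
   memorylessness P(0 < r_n, X_n > r_n + c) is exp (- lambda c) times
   P(0 < r_n < X_n); the events on the right are disjoint and almost surely one of
   them occurs, so P(Z_T > z) = exp (- lambda c). *)

Require Import Defs.
From mathcomp Require Import all_boot all_order all_algebra finmap.
From mathcomp Require Import all_classical all_reals all_analysis.
From mathcomp Require Import measurable_realfun lra.

Set Implicit Arguments.
Unset Strict Implicit.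
Unset Printing Implicit Defensive.

Import Order.TTheory GRing.Theory Num.Theory.
Import numFieldNormedType.Exports.

Local Open Scope classical_set_scope.
Local Open Scope ring_scope.

(** * Comparison sets and equality up to null sets *)

Lemma measurable_setltr d (T : measurableType d) (R : realType) (f g : T -> R) :
  measurable_fun setT f -> measurable_fun setT g ->
  measurable [set x | f x < g x].
Proof.
move=> mf mg; rewrite -[X in measurable X]setTI.
exact: (measurable_fun_ltr mf mg measurableT (Y := [set true])).
Qed.

Lemma measurable_setler d (T : measurableType d) (R : realType) (f g : T -> R) :
  measurable_fun setT f -> measurable_fun setT g ->
  measurable [set x | f x <= g x].
Proof.
move=> mf mg; rewrite -[X in measurable X]setTI.
exact: (measurable_fun_ler mf mg measurableT (Y := [set true])).
Qed.

Lemma eq_measure_outside_null d (T : measurableType d) (R : realType)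
    (mu : {measure set T -> \bar R}) (A B N : set T) :
  measurable A -> measurable B -> measurable N -> mu N = 0 ->
  (forall x, ~ N x -> A x <-> B x) -> mu A = mu B.
Proof.
move=> mA mB mN N0 AB.
have le C D : measurable C -> measurable D -> (forall x, ~ N x -> C x -> D x) ->
    (mu C <= mu D)%E.
  move=> mC mD CD; rewrite -(measureU0 mD mN N0); apply: le_measure.
  - by rewrite inE.
  - by rewrite inE; exact: measurableU.
  - by move=> x Cx; have [Nx|nNx] := pselect (N x); [right|left; exact: CD].
by apply/eqP; rewrite eq_le !le// => x /AB[].
Qed.

(** * Independence of the past *)

(* A pi-system generating the sigma-algebra of X 0, ..., X n.-1. *)
Definition past (Omega : Type) (R : realType) (X : nat -> Omega -> R) (n : nat) :
    set (set Omega) :=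
  [set \bigcap_(i in `I_n) (X i @^-1` A i) | A in [set A : nat -> set R |
    forall i, measurable (A i)]].

Lemma setI_closed_past (Omega : Type) (R : realType) (X : nat -> Omega -> R) n :
  setI_closed (past X n).
Proof.
move=> _ _ [A mA <-] [B mB <-]; exists (fun i => A i `&` B i).
  by move=> i; exact: measurableI.
by rewrite -bigcapI; apply: eq_bigcapr => i _; rewrite preimage_setI.
Qed.

Lemma measurable_past (Omega : pointedType) (R : realType) (X : nat -> Omega -> R)
    (n i : nat) : (i < n)%N ->
  measurable_fun [set: g_sigma_algebraType (past X n)]
    (X i : g_sigma_algebraType (past X n) -> R).
Proof.
move=> ltin _ B mB; rewrite setTI; apply: sub_sigma_algebra.
exists (fun j => if j == i then B else setT) => [j|].
  by case: ifP => // _; exact: measurableT.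
apply/seteqP; split => w /=.
  by move/(_ i ltin); rewrite eqxx.
by move=> Bw j _; case: eqP => [->|].
Qed.

(** Both sides are finite measures in [S]. They agree on the pi-system [past], by mutual
    independence, hence on the sigma-algebra it generates. *)
Lemma independent_past d (Omega : measurableType d) (R : realType)
    (P : probability Omega R) (X : nat -> {RV P >-> R}) (n : nat)
    (S : set Omega) (B : set R) :
  mutually_independent X -> <<s past (fun i => X i) n >> S -> measurable B ->
  P (S `&` X n @^-1` B) = (P S * P (X n @^-1` B))%E.
Proof.
move=> indep pastS mB.
have mXB : measurable (X n @^-1` B) by exact: measurable_funPTI.
have r0 : 0 <= fine (P (X n @^-1` B)) by exact/fine_ge0.
rewrite muleC -[P (X n @^-1` B)]fineK ?fin_num_measure//.
have mpast : past (fun i => X i) n `<=` measurable.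
  move=> _ [A mA <-]; apply: bigcap_measurableType => i _.
  exact: measurable_funPTI.
have pastT : past (fun i => X i) n setT.
  exists (fun=> setT) => [_|]; first exact: measurableT.
  by rewrite bigcapT.
apply: (g_sigma_algebra_measure_unique _ mpast (fun=> setT) (fun=> pastT) _
  (mrestr P mXB) (mscale (NngNum r0) P)) => //=.
- by rewrite bigcup_const.
- exact: setI_closed_past.
- move=> _ [A mA <-]; rewrite /mrestr /mscale /= fineK ?fin_num_measure//.
  (* [J] holds the indices below [n]. With [B] placed at index [n], independence is applied over [J]
     and over [J] with [n] added. *)
  pose J := [fset i in iota 0 n]%fset.
  have JE i : (i \in J) = (i < n)%N by rewrite !inE mem_iota.
  have -> : `I_n = [set` J] by apply/seteqP; split => i /=; rewrite JE.
  pose A' i := if i == n then B else A i.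
  have mA' i : measurable (A' i) by rewrite /A'; case: ifP.
  have nJ : n \notin J by rewrite JE ltnn.
  have A'E i : i \in J -> A' i = A i.
    by rewrite JE /A'; case: eqP => // ->; rewrite ltnn.
  have := indep (n |` J)%fset A' mA'; rewrite big_fsetU1//= {2}/A' eqxx.
  rewrite (indep J A mA) (eq_big_seq (fun i => P (X i @^-1` A i))); last first.
    by move=> i iJ /=; rewrite A'E.
  move=> <-; congr (P _); apply/seteqP; split => w /=.
    move=> [Aw Bw] i /=; rewrite in_fset1U => /orP[/eqP->|iJ].
      by rewrite /A' eqxx.
    by rewrite A'E//; exact: (Aw i iJ).
  move=> A'w; split.
    by move=> i /= iJ; rewrite -A'E//; apply: A'w; rewrite /= in_fset1U iJ orbT.
  by have := A'w n; rewrite /A' eqxx; apply; rewrite /= in_fset1U eqxx.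
- by move=> _; rewrite /mrestr setTI (le_lt_trans (probability_le1 _ _))// ltry.
Qed.

Lemma independent_past_fun d (Omega : measurableType d) (R : realType)
    (P : probability Omega R) (X : nat -> {RV P >-> R}) (n : nat) (f : Omega -> R) :
  mutually_independent X ->
  measurable_fun [set: g_sigma_algebraType (past (fun i => X i) n)]
    (f : g_sigma_algebraType (past (fun i => X i) n) -> R) ->
  forall A B, measurable A -> measurable B ->
  P (f @^-1` A `&` X n @^-1` B) = (P (f @^-1` A) * P (X n @^-1` B))%E.
Proof.
move=> indep mf A B mA mB; apply: independent_past => //.
by rewrite -[X in <<s _ >> X]setTI; exact: mf.
Qed.

(** * Memorylessness at an independent random time *)

Lemma joint_distribution_indep d (Omega : measurableType d) (R : realType)
    (P : probability Omega R) (f g : {RV P >-> R}) :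
  (forall A B, measurable A -> measurable B ->
     P (f @^-1` A `&` g @^-1` B) = (P (f @^-1` A) * P (g @^-1` B))%E) ->
  forall C : set (R * R), measurable C ->
  P [set w | C (f w, g w)] =
  (\int[distribution P f]_x distribution P g (xsection C x))%E.
Proof.
move=> fg C mC.
pose h : {RV P >-> (R * R)%type} := mfun_Sub (mem_set
  (measurable_fun_pair (measurable_funPT f) (measurable_funPT g))).
(* The joint law agrees with the product law on rectangles, hence everywhere; the iterated integral
   is the product measure of [C]. *)
symmetry; apply: (@product_measure_unique _ _ _ _ _ (distribution P f)
  (distribution P g) (distribution P h) _ C mC) => A B mA mB.
exact: fg.
Qed.

(** Given [f] equal to some x > 0, the tail of [g] at x + c is a product of exponentials, so the
    factor in c leaves the integral over the law of [f]. The remaining integral is identified by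
    taking c = 0. *)
Lemma memoryless_indep d (Omega : measurableType d) (R : realType)
    (P : probability Omega R) (f g : {RV P >-> R}) (lambda c : R) :
  (forall A B, measurable A -> measurable B ->
     P (f @^-1` A `&` g @^-1` B) = (P (f @^-1` A) * P (g @^-1` B))%E) ->
  (forall x, 0 < x -> P [set w | x < g w] = (expR (- (lambda * x)))%:E) ->
  0 <= c ->
  P [set w | 0 < f w /\ f w + c < g w] =
  ((expR (- (lambda * c)))%:E * P [set w | (0 < f w < g w)%R])%E.
Proof.
move=> fg tail c0.
pose K e : set (R * R) := [set xy | 0 < xy.1 /\ xy.1 + e < xy.2].
have mK e : measurable (K e).
  have -> : K e = [set xy | 0 < xy.1] `&` [set xy | xy.1 + e < xy.2] by [].
  apply: measurableI; apply: measurable_setltr => //.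
  by apply: measurable_funD => //; exact: measurable_fst.
have PK e : 0 <= e -> P [set w | 0 < f w /\ f w + e < g w] =
    ((expR (- (lambda * e)))%:E * \int[distribution P f]_x
      (if (0 < x)%R then (expR (- (lambda * x)))%:E else 0))%E.
  move=> e0; rewrite (joint_distribution_indep fg (mK e)) -ge0_integralZl//.
  - apply: eq_integral => x _; case: ifPn => x0.
      rewrite -EFinM -expRD -opprD -mulrDr [e + x]addrC.
      rewrite -tail; last by rewrite ltr_wpDr.
      congr (P _); apply/seteqP; split => w; rewrite /= /xsection /= inE /K /=.
        by case.
      by [].
    rewrite mule0 (_ : xsection _ _ = set0) ?measure0//.
    by rewrite -subset0 => y; rewrite /xsection /= inE /K /= (negbTE x0) => -[].
  - apply: measurable_fun_ifT => //.
      exact: measurable_fun_ltr.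
    apply/measurable_EFinP; apply: measurableT_comp => //.
    by apply: measurableT_comp => //; exact: measurable_funM.
  - by move=> x _; case: ifP => _ //; rewrite lee_fin expR_ge0.
rewrite PK//; have := PK 0 (lexx 0); rewrite mulr0 oppr0 expR0 mul1e => <-.
congr (_ * P _)%E; apply/seteqP; split => w /=; rewrite addr0.
  by case=> -> ->.
by case/andP.
Qed.

(** Each section of the diagonal is a point, null for the law of [g]. This will exclude ties between
    a gap and its residual. *)
Lemma indep_continuous_neq d (Omega : measurableType d) (R : realType)
    (P : probability Omega R) (f g : {RV P >-> R}) :
  (forall A B, measurable A -> measurable B ->
     P (f @^-1` A `&` g @^-1` B) = (P (f @^-1` A) * P (g @^-1` B))%E) ->
  (forall x, P [set w | g w = x] = 0) ->
  P [set w | g w = f w] = 0.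
Proof.
move=> fg g0.
pose K : set (R * R) := [set xy | xy.2 = xy.1].
have mK : measurable K.
  rewrite -[X in measurable X]setTI.
  have -> : K = (fun xy => xy.2 == xy.1) @^-1` [set true].
    by apply/seteqP; split => xy /= /eqP.
  exact: (measurable_fun_eqr measurable_snd measurable_fst measurableT).
rewrite (joint_distribution_indep fg mK).
apply: integral0_eq => x _; rewrite -[RHS](g0 x); congr (P _).
by apply/seteqP; split => w; rewrite /= /xsection /K /= inE.
Qed.
(** * Paths of the timing process *)

Lemma first_long_inter_renewal (Omega : Type) (R : realType)
    (X : nat -> Omega -> R) (alpha : R) (w : Omega) :
  (exists n, alpha < X n w) ->
  exists2 N, forall i, (i < N)%N -> X i w <= alpha & alpha < X N w.
Proof.
move=> ex; have [N big min] := ex_minnP ex; exists N => // i iN.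
by rewrite leNgt; apply: contraL iN => /min; rewrite leqNgt.
Qed.

(* The time left after the n-th renewal until a clock rings that lasts v and
   starts at the first renewal after which no renewal occurs for longer than
   alpha: it stays equal to v as long as all gaps are at most alpha, and is
   negative once the clock has rung.  It depends on the first n gaps only. *)
Definition residual (Omega : Type) (R : realType) (X : nat -> Omega -> R)
    (alpha v : R) (n : nat) (w : Omega) : R :=
  v - \sum_(i < n) (if has (fun j => alpha < X j w) (iota 0 i.+1) then X i w else 0).

Section paths.
Context {Omega : Type} {R : realType}.
Variables (X : nat -> Omega -> R) (w : Omega).
Hypothesis X_gt0 : forall i, 0 < X i w.
Local Notation Y n := (renewal_time X n w).
Local Notation Z s := (timing_process X s w).

Lemma renewal_time0 : Y 0%N = 0.
Proof. by rewrite /renewal_time big_ord0. Qed.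

Lemma renewal_timeS n : Y n.+1 = Y n + X n w.
Proof. by rewrite /renewal_time big_ord_recr. Qed.

Lemma lt_renewal_timeS n : Y n < Y n.+1.
Proof. by rewrite renewal_timeS ltrDl. Qed.

Lemma le_renewal_time : {homo (fun n => Y n) : m n / (m <= n)%N >-> m <= n}.
Proof.
apply: homo_leq => [x|y x z|n] //; first exact: le_trans.
exact/ltW/lt_renewal_timeS.
Qed.

Lemma renewal_time_ge0 n : 0 <= Y n.
Proof. by rewrite -renewal_time0; exact: le_renewal_time. Qed.

Lemma renewal_time_bracket s n : 0 <= s -> s < Y n ->
  exists2 m, (m < n)%N & Y m <= s < Y m.+1.
Proof.
move=> s0; elim: n => [|n IHn]; first by rewrite renewal_time0 ltNge s0.
have [sYn _|Yns ltYS] := ltP s (Y n); last by exists n => //; rewrite Yns.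
by have [m mn Ym] := IHn sYn; exists m => //; exact: ltnW.
Qed.

Lemma timing_process_le s n : Y n <= s -> Z s <= s - Y n.
Proof.
move=> Yns; apply: ge_inf; first by exists 0 => _ [m /= ? <-].
by exists n => //=; rewrite subr_ge0.
Qed.

(** The set contains [s], through n = 0, so its infimum is below [q] exactly when some element is.
    The countable quantifier later yields measurability. *)
Lemma timing_process_ltP s q : 0 <= s ->
  Z s < q <-> exists n, Y n <= s /\ s - Y n < q.
Proof.
move=> s0; split=> [|[n [Yns]]]; last exact/le_lt_trans/timing_process_le.
move=> /inf_lt[|y [n /= Yns <-] lt]; last by exists n; rewrite -subr_ge0.
by exists s; exists 0%N; rewrite /= renewal_time0 subr0.
Qed.

Lemma le_timing_process s q : 0 <= s ->
  (forall n, Y n <= s -> q <= s - Y n) -> q <= Z s.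
Proof.
move=> s0 lb; rewrite leNgt; apply/negP => /(timing_process_ltP _ s0)[n [Yns]].
by rewrite ltNge lb.
Qed.

Lemma timing_process_ge0 s : 0 <= s -> 0 <= Z s.
Proof. by move=> s0; apply: le_timing_process => // n; rewrite subr_ge0. Qed.

Lemma timing_process_between s n : Y n <= s < Y n.+1 -> Z s = s - Y n.
Proof.
case/andP=> Yns sYn.
have s0 : 0 <= s by exact: le_trans (renewal_time_ge0 n) Yns.
apply/eqP; rewrite eq_le timing_process_le//=.
apply: le_timing_process => // m Yms; rewrite lerB//.
apply: le_renewal_time; rewrite leqNgt; apply/negP => /le_renewal_time.
by rewrite leNgt (le_lt_trans Yms).
Qed.

Lemma hitting_timeE alpha s : 0 <= s -> Z s = alpha ->
  (forall r, 0 <= r -> Z r = alpha -> s <= r) -> hitting_time X alpha w = s%:E.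
Proof.
move=> s0 Zs lb; apply/eqP; rewrite eq_le; apply/andP; split.
  by apply: ereal_inf_lbound; exists s.
by apply: le_ereal_inf_tmp => _ [r [r0 Zr] <-]; rewrite lee_fin lb.
Qed.

(** Before [Y n], time [s] lies in a gap of length at most [alpha], and the age inside a gap is
    strictly less than its length. *)
Lemma timing_process_lt_level alpha n s : (forall i, (i < n)%N -> X i w <= alpha) ->
  0 <= s -> s < Y n -> Z s < alpha.
Proof.
move=> small s0 sYn; have [m mn Yms] := renewal_time_bracket s0 sYn.
rewrite (timing_process_between Yms) (lt_le_trans _ (small m mn))//.
by case/andP: Yms => _; rewrite renewal_timeS ltrBlDl.
Qed.

(** The age stays strictly below [alpha] up to [Y N], even in a gap of length exactly [alpha]. It
    then grows from 0 along a gap long enough to reach [alpha]. *)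
Lemma hitting_time_first alpha N : 0 <= alpha ->
  (forall i, (i < N)%N -> X i w <= alpha) -> alpha < X N w ->
  hitting_time X alpha w = (Y N + alpha)%:E.
Proof.
move=> alpha0 small big; have YN0 := renewal_time_ge0 N.
apply: hitting_timeE.
- exact: addr_ge0.
- rewrite (@timing_process_between _ N); first by rewrite addrAC subrr add0r.
  by rewrite lerDl alpha0 renewal_timeS ltrD2l.
- move=> r r0 Zr; rewrite leNgt; apply/negP => ltr.
  have [rYN|YNr] := ltP r (Y N).
    by have := timing_process_lt_level small r0 rYN; rewrite Zr ltxx.
  move: Zr; rewrite (@timing_process_between _ N); first by lra.
  by rewrite YNr renewal_timeS (lt_trans ltr)// ltrD2l.
Qed.

(** There is no last renewal before the supremum S: the differences S + r - [Y n] have infimum r. *)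
Lemma timing_process_explosion r : has_ubound (range (fun n => Y n)) ->
  0 <= r -> Z (sup (range (fun n => Y n)) + r) = r.
Proof.
set S := sup _ => ubY r0.
have supY : has_sup (range (fun n => Y n)) by split=> //; exists (Y 0%N); exists 0%N.
have YS n : Y n <= S by apply: ub_le_sup => //; exists n.
have S0 : 0 <= S by exact: le_trans (renewal_time_ge0 0) (YS 0%N).
apply/eqP; rewrite eq_le; apply/andP; split; last first.
  apply: le_timing_process => [|n _]; first exact: addr_ge0.
  by have := YS n; lra.
rewrite leNgt; apply/negP; rewrite -subr_gt0 => gt.
have [_ [n _ <-]] := sup_adherent gt supY; rewrite -/S => ltY.
have : Z (S + r) <= S + r - Y n.
  by apply: timing_process_le; rewrite (le_trans (YS n))// lerDl.
by move: ltY; lra.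
Qed.

(** Before the supremum S the age is below [alpha]; from S on it is the time elapsed since S. *)
Lemma hitting_time_explosion alpha : 0 <= alpha ->
  (forall i, X i w <= alpha) -> has_ubound (range (fun n => Y n)) ->
  hitting_time X alpha w = (sup (range (fun n => Y n)) + alpha)%:E.
Proof.
move=> alpha0 small ubY; have ZS := timing_process_explosion ubY.
set S := sup _ in ZS *.
have S0 : 0 <= S.
  apply: (@le_trans _ _ (Y 0)); first exact: renewal_time_ge0.
  by apply: ub_le_sup => //; exists 0%N.
apply: hitting_timeE; [exact: addr_ge0|exact: ZS|move=> r r0 Zr].
have [rS|Sr] := ltP r S; last first.
  by move: Zr; rewrite -(subrKC S r) ZS ?subr_ge0// => <-.
have [|_ [n _ <-] rY] := sup_gt _ rS; first by exists (Y 0%N); exists 0%N.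
by have := timing_process_lt_level (fun i _ => small i) r0 rY; rewrite Zr ltxx.
Qed.

Lemma hitting_time_unbounded alpha : (forall i, X i w <= alpha) -> 
  (forall s, exists n, s < Y n) -> hitting_time X alpha w = +oo%E.
Proof.
move=> small unb; apply/ereal_inf_pinfty => _ [s [s0 Zs] <-].
have [n sYn] := unb s.
by have := timing_process_lt_level (fun i _ => small i) s0 sYn; rewrite Zs ltxx.
Qed.

(** * The residual of the clock and its crossing *)

Local Notation r alpha v n := (residual X alpha v n w).

Lemma residualS alpha v n : r alpha v n.+1 = r alpha v n -
  (if has (fun j => alpha < X j w) (iota 0 n.+1) then X n w else 0).
Proof. by rewrite /residual big_ord_recr /= opprD addrA. Qed.

Lemma residual_before alpha v n : (forall i, (i < n)%N -> X i w <= alpha) ->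
  r alpha v n = v.
Proof.
elim: n => [_|n IHn small]; first by rewrite /residual big_ord0 subr0.
rewrite residualS IHn => [|i ltin]; last exact/small/ltnW.
rewrite ifF ?subr0//; apply/hasPn => i; rewrite mem_iota add0n /= => lein.
by rewrite -leNgt small.
Qed.

(** The test at index i includes i itself, so the long gap [X N] is already subtracted and the clock
    starts at [Y N], where that gap begins. *)
Lemma residual_after alpha v N n : (forall i, (i < N)%N -> X i w <= alpha) ->
  alpha < X N w -> (N <= n)%N -> r alpha v n = v - (Y n - Y N).
Proof.
move=> small big; elim: n => [|n IHn].
  by rewrite leqn0 => /eqP ->; rewrite residual_before// subrr subr0.
rewrite leq_eqVlt => /predU1P[<-|leNn].
  by rewrite residual_before// subrr subr0.
rewrite residualS IHn// ifT; first by rewrite renewal_timeS; lra.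
by apply/hasP; exists N; rewrite ?mem_iota.
Qed.

Lemma le_residual alpha v : {homo (fun n => r alpha v n) : m n / (m <= n)%N >-> n <= m}.
Proof.
apply: homo_leq => [x|y x z yx zy|n] //; first exact: le_trans zy yx.
by rewrite residualS gerBl; case: ifP => // _; exact: ltW.
Qed.

(** This makes the crossing events disjoint. If gap [m] is subtracted, the residual turns negative
    and never increases again. Otherwise the residual is still [v], at least [alpha], and gap [m]
    cannot exceed it. *)
Lemma residual_overshoot alpha v m n : alpha <= v -> (m < n)%N ->
  r alpha v m < X m w -> r alpha v n < 0.
Proof.
move=> av mn; apply: contraTT; rewrite -!leNgt => r0.
have := le_trans r0 (le_residual alpha v mn); rewrite residualS.
case: ifPn => [_|/hasPn none _]; first by rewrite subr_ge0.
rewrite residual_before; last first.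
  by move=> i im; rewrite leNgt none// mem_iota leq0n add0n ltnW.
by rewrite (le_trans _ av)// leNgt none// mem_iota add0n ltnSn.
Qed.

(** Without a crossing, and with ties excluded, each gap is below the current residual, which thus
    stays positive forever. As it never exceeds [v], no gap could exceed [v]. *)
Lemma residual_crossing alpha v : 0 < v ->
  (forall n, 0 < r alpha v n -> X n w <> r alpha v n) ->
  (exists n, v < X n w) -> exists n, 0 < r alpha v n < X n w.
Proof.
move=> v0 neq [N vXN]; apply: contrapT => none.
have r_le n : r alpha v n <= v.
  by rewrite -[leRHS](@residual_before alpha v 0)//; exact: (le_residual alpha v (leq0n n)).
have gt n : 0 < r alpha v n -> X n w < r alpha v n.
  move=> rn; rewrite lt_neqAle; apply/andP; split; first exact/eqP/neq.
  by rewrite leNgt; apply/negP => lt; apply: none; exists n; rewrite rn.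
have r_gt0 n : 0 < r alpha v n.
  elim: n => [|n IHn]; first by rewrite residual_before.
  by rewrite residualS; case: ifP => _; [rewrite subr_gt0 gt|rewrite subr0].
by have := gt N (r_gt0 N); rewrite ltNge (le_trans (r_le N))// ltW.
Qed.

(** With T = [Y N + alpha + t] and c = [Num.min z t], [v] is the time from [Y N] to T - c. The right
    side amounts to a gap of index at least [N] that covers [T - c, T]. *)
Lemma timing_process_from_gtP alpha t z N : 0 <= alpha -> 0 <= t ->
  0 <= z -> z < t + alpha ->
  (forall i, (i < N)%N -> X i w <= alpha) -> alpha < X N w ->
  (forall s, exists n, s < Y n) ->
  let v := alpha + Num.max (t - z) 0 in
  z < timing_process_from X alpha t w <->
  exists n, 0 < r alpha v n /\ r alpha v n + Num.min z t < X n w.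
Proof.
move=> alpha0 t0 z0 zta small big unb v.
rewrite /timing_process_from (hitting_time_first alpha0 small big) /=.
have vE : v = alpha + t - Num.min z t.
  by rewrite /v; case: (leP z t); case: (leP (t - z) 0); lra.
have T0 : 0 <= Y N + alpha + t by rewrite !addr_ge0// renewal_time_ge0.
have minz : Num.min z t <= z by rewrite ge_min lexx.
split.
  (* The witness is the index of the gap containing the observation time. *)
  have [n0 Tn0] := unb (Y N + alpha + t).
  have [n _ /andP[YT TY]] := renewal_time_bracket T0 Tn0.
  rewrite (@timing_process_between _ n) ?YT// => zlt.
  have Nn : (N <= n)%N.
    rewrite leqNgt; apply/negP => /le_renewal_time le.
    by move: TY; rewrite ltNge (le_trans le)// -addrA lerDl addr_ge0.
  exists n; rewrite (residual_after v small big Nn) vE.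
  by move: TY; rewrite renewal_timeS; split; lra.
move=> [n [rn0 rnX]].
(* For [n < N] the residual is [v], and the condition would read [alpha + t < X n w]. *)
have Nn : (N <= n)%N.
  rewrite leqNgt; apply/negP => nN; move: rnX; rewrite residual_before; last first.
    by move=> i /ltn_trans/(_ nN)/small.
  by rewrite vE subrK ltNge (le_trans (small _ nN))// lerDl.
move: rn0 rnX; rewrite (residual_after v small big Nn) vE => rn0 rnX.
have min0 : 0 <= Num.min z t by rewrite le_min z0.
have Tn : Y n <= Y N + alpha + t < Y n.+1.
  by rewrite renewal_timeS; apply/andP; split; lra.
rewrite (timing_process_between Tn).
have [zt|tz] := leP z t; first by move: rn0; rewrite (min_l zt); lra.
(* Here c = [t], so a positive residual means [Y n < Y N + alpha], which is before the next renewal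
   after [Y N]. *)
have YnN : Y n <= Y N.
  apply: le_renewal_time; rewrite leqNgt; apply/negP => /le_renewal_time.
  by move: rn0; rewrite (min_r (ltW tz)) renewal_timeS; lra.
lra.
Qed.

End paths.

Lemma timing_process_from_ge0 (Omega : Type) (R : realType)
    (X : nat -> Omega -> R) (alpha t : R) (w : Omega) :
  0 <= t -> 0 <= timing_process_from X alpha t w.
Proof.
move=> t0; apply: timing_process_ge0; rewrite addr_ge0// fine_ge0//.
by apply: le_ereal_inf_tmp => _ [s [s0 _] <-]; rewrite lee_fin.
Qed.

(** * Measurability *)

Section measurability.
Context d (Omega : measurableType d) (R : realType).
Variable X : nat -> Omega -> R.
Hypothesis mX : forall i, measurable_fun setT (X i).
Hypothesis X_gt0 : forall i w, 0 < X i w.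

Lemma measurable_renewal_time n : measurable_fun setT (renewal_time X n).
Proof. by apply: measurable_sum => i; exact: mX. Qed.

(** The time is random because the process is later observed at [renewal_time X N w + alpha + t]. *)
Lemma measurable_timing_process (s : Omega -> R) :
  measurable_fun setT s -> (forall w, 0 <= s w) ->
  measurable_fun setT (fun w => timing_process X (s w) w).
Proof.
move=> ms s0 _; apply: (measurability _ (RGenInftyO.measurableE R)) => //.
move=> _ [_ [q ->] <-]; rewrite setTI.
rewrite [X in measurable X](_ : _ = \bigcup_n
  ([set w | renewal_time X n w <= s w] `&`
   [set w | s w - renewal_time X n w < q])).
  apply: bigcupT_measurable => n; have mY := measurable_renewal_time n.
  apply: measurableI; first exact: measurable_setler.
  by apply: measurable_setltr => //; exact: measurable_funB.
apply/seteqP; split => w /=; rewrite in_itv /=.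
  by move/(timing_process_ltP _ _ _ (s0 w)) => [n Yn]; exists n.
by move=> [n _ Yn]; apply/(timing_process_ltP _ _ _ (s0 w)); exists n.
Qed.

(* P need not be complete, so the null event that no gap exceeds alpha has to be
   examined too: there the hitting time is infinite, and replaced by 0, unless the
   renewals accumulate. *)
Lemma measurable_timing_process_from_le alpha t z : 0 <= alpha -> 0 <= t ->
  measurable [set w | timing_process_from X alpha t w <= z].
Proof.
move=> alpha0 t0.
(* Three cases: a first gap longer than [alpha]; none, with accumulating renewals; none, without
   accumulation. The process is explicit in each. *)
pose first N := [set w | forall i, (i < N)%N -> X i w <= alpha] `&`
  [set w | alpha < X N w].
pose never := \bigcap_i [set w | X i w <= alpha].
pose explodes := \bigcup_k \bigcap_n [set w | renewal_time X n w <= k%:R].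
have mle i a : measurable [set w | X i w <= a] by exact: measurable_setler.
have mfirst N : measurable (first N).
  apply: measurableI; last exact: measurable_setltr.
  rewrite [X in measurable X](_ : _ = \bigcap_(i in `I_N) [set w | X i w <= alpha]).
    exact: bigcap_measurableType.
  by apply/seteqP; split.
have mnever : measurable never by exact: bigcap_measurableType.
have mexplodes : measurable explodes.
  apply: bigcupT_measurable => k; apply: bigcap_measurableType => n _.
  by apply: measurable_setler => //; exact: measurable_renewal_time.
have explodesP w : explodes w <-> has_ubound (range (renewal_time X ^~ w)).
  split=> [[k _ Yk]|[b ub]].
    by exists k%:R => _ [n _ <-]; exact: Yk.
  exists (Num.truncn b).+1 => // n _ /=.
  have Yb : renewal_time X n w <= b by apply: ub; exists n.
  by rewrite (le_trans Yb)// ltW// truncnS_gt.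
rewrite [X in measurable X](_ : _ =
  \bigcup_N (first N `&`
    [set w | timing_process X (renewal_time X N w + alpha + t) w <= z]) `|`
  (never `&` explodes `&` [set w | alpha + t <= z]) `|`
  ((never `\` explodes) `&` [set w | timing_process X t w <= z])).
  apply: measurableU; first apply: measurableU.
  - apply: bigcupT_measurable => N; apply: measurableI => //.
    apply: measurable_setler => //; apply: measurable_timing_process.
      do 2 (apply: measurable_funD => //); exact: measurable_renewal_time.
    by move=> w; rewrite !addr_ge0// renewal_time_ge0.
  - by apply: measurableI; [exact: measurableI|exact: measurable_setler].
  - apply: measurableI; first exact: measurableD.
    by apply: measurable_setler => //; exact: measurable_timing_process.
have fromE N w : first N w -> timing_process_from X alpha t w =
    timing_process X (renewal_time X N w + alpha + t) w.
  move=> [small big]; rewrite /timing_process_from.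
  by rewrite (hitting_time_first (X_gt0 ^~ w) alpha0 small big).
have neverE w : never w -> explodes w ->
    timing_process_from X alpha t w = alpha + t.
  move=> small /explodesP ubY; rewrite /timing_process_from.
  rewrite (hitting_time_explosion (X_gt0 ^~ w) alpha0 (fun i => small i I) ubY) /=.
  by rewrite -addrA (timing_process_explosion (X_gt0 ^~ w) ubY)// addr_ge0.
have neverNE w : never w -> ~ explodes w ->
    timing_process_from X alpha t w = timing_process X t w.
  move=> small nex; rewrite /timing_process_from.
  rewrite (hitting_time_unbounded (X_gt0 ^~ w) (fun i => small i I)) /=.
    by rewrite add0r.
  move=> s; apply: contrapT => none; apply: nex; apply/explodesP.
  by exists s => _ [n _ <-]; rewrite leNgt; apply/negP => lt; apply: none; exists n.
apply/seteqP; split => w /=.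
  move=> Ez; have [nev|] := pselect (never w).
    have [ex|nex] := pselect (explodes w).
      by left; right; split => //; rewrite -(neverE w).
    by right; split => //; rewrite -neverNE.
  move=> nnev; have [|N small big] := @first_long_inter_renewal _ _ X alpha w.
    apply: contrapT => none; apply: nnev => i _ /=; rewrite leNgt; apply/negP.
    by move=> lt; apply: none; exists i.
  have fN : first N w by split.
  by left; left; exists N => //; split => //=; rewrite -(fromE N).
move=> [[[N _ [fN /=]]|[[nev ex]]]|[[nev nex]]].
- by rewrite -(fromE N).
- by rewrite -(neverE w).
- by rewrite -neverNE.
Qed.

End measurability.

(** Only the first [n] gaps enter and [T] is arbitrary, so this applies both to Omega and to the
    sigma-algebra of the past. *)
Lemma measurable_residual d (T : measurableType d) (R : realType)
    (X : nat -> T -> R) alpha v n :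
  (forall i, (i < n)%N -> measurable_fun setT (X i)) ->
  measurable_fun setT (residual X alpha v n).
Proof.
elim: n => [_|n IHn mX].
  rewrite (_ : residual _ _ _ _ = cst v); first exact: measurable_cst.
  by apply/funext => w; rewrite /residual big_ord0 subr0.
rewrite (_ : residual X alpha v n.+1 = residual X alpha v n \-
    (fun w => if has (fun j => alpha < X j w) (iota 0 n.+1) then X n w else 0)).
  apply: measurable_funB; first by apply: IHn => i /ltnW; exact: mX.
  apply: measurable_fun_ifT => //; last exact: mX.
  have : {subset iota 0 n.+1 <= gtn n.+1} by move=> i; rewrite mem_iota.
  elim: (iota _ _) => [|j s IHs] sub; first exact: measurable_cst.
  apply: measurable_or.
    by apply: measurable_fun_ltr => //; apply/mX/sub; rewrite inE eqxx.
  by apply: IHs => i si; apply: sub; rewrite inE si orbT.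
by apply/funext => w; rewrite residualS.
Qed.

(** * Exponential inter-renewal times *)

Section exponential_renewals.
Context d (Omega : measurableType d) (R : realType) (P : probability Omega R).
Variables (X : nat -> {RV P >-> R}) (lambda : R).
Hypothesis lambda_gt0 : 0 < lambda.
Hypothesis hX : inter_renewal_times (exponential_prob lambda) X.
Local Notation x := (fun i => X i : Omega -> R).

Let mX i : measurable_fun setT (X i : Omega -> R).
Proof. exact: measurable_funPT. Qed.

Let X_gt0 i w : 0 < X i w.
Proof. by case: hX. Qed.

Lemma inter_renewal_le n a : 0 < a ->
  P [set w | X n w <= a] = (1 - (expR (- (lambda * a)))%:E)%E.
Proof.
move=> a0; case: hX => _ _ law.
rewrite -mulNr -exponential_prob_itv0c// -(law n)//.
congr (P _); apply/seteqP; split => w /=; rewrite in_itv /=.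
  by move=> ->; rewrite ltW.
by case/andP.
Qed.

Lemma inter_renewal_tail n a : 0 < a ->
  P [set w | a < X n w] = (expR (- (lambda * a)))%:E.
Proof.
move=> a0; rewrite (_ : [set w | _] = ~` [set w | X n w <= a]).
  rewrite probability_setC; last exact: measurable_setler.
  by rewrite inter_renewal_le// -!EFinB; congr EFin; lra.
by apply/seteqP; split => w /=; rewrite ltNge => /negP.
Qed.

Lemma inter_renewal_eq n a : P [set w | X n w = a] = 0.
Proof.
by case: hX => _ _ law; rewrite probability_distribution law// /exponential_prob integral_set1.
Qed.

(** For [a > 0] the first n gaps are all at most [a] with probability q^n, where q < 1 is the
    probability for one gap. *)
Lemma inter_renewals_bounded_null a : P (\bigcap_n [set w | X n w <= a]) = 0.
Proof.
have mle i b : measurable [set w | X i w <= b] by exact: measurable_setler.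
have m_all b : measurable (\bigcap_n [set w | X n w <= b]).
  exact: bigcap_measurableType.
have [a_le0|a0] := leP a 0.
  rewrite (_ : \bigcap_n _ = set0) ?measure0// -subset0 => w /(_ 0%N I) /=.
  by rewrite leNgt (le_lt_trans a_le0).
pose q := 1 - expR (- (lambda * a)).
have q0 : 0 <= q by rewrite subr_ge0 -expR0 ler_expR oppr_le0 ltW ?mulr_gt0.
have q1 : q < 1 by rewrite ltrBlDr ltrDl expR_gt0.
have Pn n : P (\bigcap_(i in `I_n) X i @^-1` [set y | y <= a]) = (q ^+ n)%:E.
  elim: n => [|n IHn]; first by rewrite II0 bigcap_set0 probability_setT.
  rewrite IIS bigcap_setU bigcap_set1 independent_past.
  - by rewrite IHn [P (_ @^-1` _)]inter_renewal_le// -EFinB -EFinM exprSr.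
  - by case: hX.
  - apply: sub_sigma_algebra; exists (fun=> [set y | y <= a]) => // _.
    exact: measurable_setler.
  - exact: measurable_setler.
apply/eqP; rewrite eq_le measure_ge0 andbT.
have qn : (q ^+ n)%:E @[n --> \oo] --> 0%E.
  by apply: cvg_EFin; [exact: nearW|apply: cvg_expr; rewrite ger0_norm].
rewrite -(cvg_lim _ qn)//; apply: lime_ge; first by apply/cvg_ex; exists 0%E.
apply: nearW => n; rewrite -Pn; apply: le_measure; rewrite ?inE//.
  by apply: bigcap_measurableType => i _; exact: mle.
by move=> w all_le i _; exact: all_le.
Qed.

(** Memorylessness extracts the factor from each event; summing over disjoint events reduces the
    claim to c = 0, where a crossing is almost sure. *)
Lemma probability_crossing alpha v c : 0 < v -> alpha <= v -> 0 <= c ->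
  P (\bigcup_n [set w | 0 < residual x alpha v n w /\
                        residual x alpha v n w + c < X n w]) =
  (expR (- (lambda * c)))%:E.
Proof.
move=> v0 av c0; have [_ indep _] := hX.
pose K e n := [set w | 0 < residual x alpha v n w /\
                       residual x alpha v n w + e < X n w].
have mr n : measurable_fun setT (residual x alpha v n) by exact: measurable_residual.
have mK e n : measurable (K e n).
  by apply: measurableI; apply: measurable_setltr => //; exact: measurable_funD.
pose r n : {RV P >-> R} := mfun_Sub (mem_set (mr n)).
have indep_r n A B : measurable A -> measurable B ->
    P (r n @^-1` A `&` X n @^-1` B) = (P (r n @^-1` A) * P (X n @^-1` B))%E.
  apply: independent_past_fun => //.
  by apply: measurable_residual => i; exact: measurable_past.
have PK n : P (K c n) = ((expR (- (lambda * c)))%:E * P (K 0%R n))%E.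
  rewrite /K (memoryless_indep (indep_r n) (inter_renewal_tail n) c0).
  congr (_ * P _)%E; apply/seteqP; split => w /=; rewrite addr0.
    by case/andP.
  by case=> -> ->.
have disj e : 0 <= e -> trivIset setT (K e).
  move=> e0; apply: ltn_trivIset => n m mn; rewrite -subset0 => w [[_ rX] [rn0 _]].
  have := @residual_overshoot _ _ x w (X_gt0 ^~ w) _ _ _ _ av mn (le_lt_trans _ rX).
  by rewrite lerDl => /(_ e0); rewrite ltNge ltW.
have PU : P (\bigcup_n K c n) = ((expR (- (lambda * c)))%:E * P (\bigcup_n K 0%R n))%E.
  rewrite !measure_bigcup//; [|exact: disj..].
  by rewrite -nneseriesZl//; apply: eq_eseriesr => n _; exact: PK.
rewrite PU -[RHS]mule1 -(probability_setT P); congr (_ * _)%E.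
(* Outside [N] no gap ties with its residual and some gap exceeds [v], so [residual_crossing]
   applies. *)
pose N := \bigcup_n [set w | X n w = r n w] `|` \bigcap_n [set w | X n w <= v].
have meq n : measurable [set w | X n w = r n w].
  rewrite (_ : [set w | _] = [set w | X n w <= r n w] `&` [set w | r n w <= X n w]).
    by apply: measurableI; apply: measurable_setler.
  apply/seteqP; split => w /=; first by move=> ->.
  by move=> [le ge]; apply/eqP; rewrite eq_le le ge.
have mN1 : measurable (\bigcup_n [set w | X n w = r n w]).
  exact: bigcupT_measurable.
have mN2 : measurable (\bigcap_n [set w | X n w <= v]).
  by apply: bigcap_measurableType => n _; exact: measurable_setler.
apply: (@eq_measure_outside_null _ _ _ P _ _ N) => //.
- exact: bigcupT_measurable.
- exact: measurableU.
- apply: null_set_setU => //; last exact: inter_renewals_bounded_null.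
  apply: measure_negligible => //; apply: negligible_bigcup => n.
  apply/negligibleP => //; apply: (indep_continuous_neq (indep_r n)).
  exact: inter_renewal_eq.
- move=> w nN; split=> // _.
  have [||n /andP[rn0 rX]] := @residual_crossing _ _ x w (X_gt0 ^~ w) alpha v v0.
  + by move=> n _ E; apply: nN; left; exists n.
  + apply: contrapT => none; apply: nN; right => n _ /=; rewrite leNgt.
    by apply/negP => lt; apply: none; exists n.
  + by exists n => //; rewrite /K /= addr0.
Qed.

(* Off this null event some gap exceeds alpha and the renewals do not
   accumulate. *)
Definition bounded_inter_renewals : set Omega :=
  \bigcup_(k : nat) \bigcap_n [set w | X n w <= k%:R].

Lemma measurable_bounded_inter_renewals : measurable bounded_inter_renewals.
Proof.
apply: bigcupT_measurable => k; apply: bigcap_measurableType => n _.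
exact: measurable_setler.
Qed.

Lemma bounded_inter_renewals_null : P bounded_inter_renewals = 0.
Proof.
apply: measure_negligible; first exact: measurable_bounded_inter_renewals.
apply: negligible_bigcup => k; apply/negligibleP.
  by apply: bigcap_measurableType => n _; exact: measurable_setler.
exact: inter_renewals_bounded_null.
Qed.

Lemma unbounded_inter_renewals w : ~ bounded_inter_renewals w ->
  forall b, exists n, b < X n w.
Proof.
move=> unb b; apply: contrapT => none; apply: unb.
exists (Num.truncn b).+1 => // n _ /=; apply: (@le_trans _ _ b).
  by rewrite leNgt; apply/negP => lt; apply: none; exists n.
exact/ltW/truncnS_gt.
Qed.

End exponential_renewals.

(** * The distribution function of the process started at [alpha] *)

Theorem theorem16 (d : measure_display) (Omega : measurableType d)
    (R : realType) (P : probability Omega R) (X : nat -> {RV P >-> R})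
    (lambda alpha : R) (hlambda : 0 < lambda) (halpha : 0 <= alpha)
    (hX : inter_renewal_times (exponential_prob lambda) X)
    (t : R) (ht : 0 <= t) (z : R) :
  P [set w | timing_process_from (fun i => X i) alpha t w <= z] =
  (if z < 0 then 0
   else if z < t then 1 - expR (- (lambda * z))
   else if z < t + alpha then 1 - expR (- (lambda * t))
   else 1)%:E.
Proof.
pose x i : Omega -> R := X i.
have X_gt0 i w : 0 < X i w by case: hX.
have mX i : measurable_fun setT (X i : Omega -> R) by exact: measurable_funPT.
have mE := measurable_timing_process_from_le mX X_gt0 z halpha ht.
have mN := measurable_bounded_inter_renewals X.
have PN := bounded_inter_renewals_null hlambda hX.
have [z_lt0|z_ge0] := ltP z 0.
  rewrite (_ : [set w | _] = set0) ?measure0// -subset0 => w /=.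
  by rewrite leNgt (lt_le_trans z_lt0)// timing_process_from_ge0.
have [z_lt|z_ge] := ltP z (t + alpha); last first.
  rewrite ltNge (le_trans _ z_ge) ?lerDl//= -(probability_setT P).
  apply: (eq_measure_outside_null mE _ mN PN) => // w.
  move=> /unbounded_inter_renewals unb.
  have [N small big] := @first_long_inter_renewal _ _ x _ _ (unb alpha).
  (* The renewal [Y N] precedes the observation time by [t + alpha], which bounds the age. *)
  split=> // _ /=; apply: le_trans z_ge; rewrite /timing_process_from.
  rewrite (@hitting_time_first _ _ x w (X_gt0 ^~ w) _ _ halpha small big) /=.
  have -> : t + alpha = renewal_time x N w + alpha + t -
    renewal_time x N w by lra.
  by apply: timing_process_le; rewrite -addrA lerDl addr_ge0.
pose v := alpha + Num.max (t - z) 0.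
have v_gt0 : 0 < v by rewrite /v; case: (leP (t - z) 0); lra.
have le_v : alpha <= v by rewrite lerDl le_max lexx orbT.
have min_ge0 : 0 <= Num.min z t by rewrite le_min z_ge0.
have := probability_crossing hlambda hX v_gt0 le_v min_ge0.
set K := \bigcup_n _ => PK.
have mK : measurable K.
  apply: bigcupT_measurable => n.
  have mr : measurable_fun setT (residual x alpha v n).
    by apply: measurable_residual => i _; exact: mX.
  by apply: measurableI; apply: measurable_setltr => //; exact: measurable_funD.
(* The complement is almost surely the crossing event with c = [Num.min z t]; the two values of c
   give the two middle cases. *)
suff PE : P (~` [set w | timing_process_from x alpha t w <= z]) = P K.
  rewrite -[X in P X]setCK probability_setC; last exact: measurableC.
  rewrite PE PK -EFinB; congr EFin.
  by have [//|//] := ltP z t.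
apply: (eq_measure_outside_null (measurableC mE) mK mN PN) => w.
move=> /unbounded_inter_renewals unb.
have [N small big] := @first_long_inter_renewal _ _ x _ _ (unb alpha).
(* A gap is at most the renewal time that ends it, so unbounded gaps rule out accumulation. *)
have unbY s : exists n, s < renewal_time x n w.
  have [n sX] := unb s; exists n.+1; rewrite renewal_timeS.
  by rewrite (lt_le_trans sX)// lerDr (@renewal_time_ge0 _ _ x w (X_gt0 ^~ w)).
have [gtK Kgt] := @timing_process_from_gtP _ _ x w (X_gt0 ^~ w) _ _ _ _
  halpha ht z_ge0 z_lt small big unbY.
split=> /= [/negP|[n _ Kn]].
  by rewrite -ltNge => /gtK[n Kn]; exists n.
by apply/negP; rewrite -ltNge; apply: Kgt; exists n.
Qed.
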